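(* Let $H=\mathbb{R}^n$ or $H=\mathbb{C}^n$, let $\{f_1,\ldots,f_m\}$ be a spanning set of $H$, let $y=(y_k)_{k=1}^m\in\mathbb{R}^m$, and for $u,v\in H$ and $\lambda,\mu\ge 0$ let $$J(u,v,\lambda,\mu)=\sum_{k=1}^m |y_k-\langle u,f_k\rangle\langle f_k,v\rangle|^2+\lambda\|u\|^2+\mu\|u-v\|^2+\lambda\|v\|^2.$$ Let $(\lambda_t)_{t\ge 0}$ and $(\mu_t)_{t\ge 0}$ be sequences of nonnegative reals with $\lambda_0\ge\lambda_1\ge\cdots\ge\lambda_t\ge\cdots$ and $\mu_0\ge\mu_1\ge\cdots\ge\mu_t\ge\cdots$. Then for any initialization $x^0\in H$, if $(x^t)_{t\ge 0}$ is generated by $x^{t+1}=\operatorname{argmin}_{u\in H}J(u,x^t,\lambda_t,\mu_t)$ and $j_t=J(x^{t+1},x^t,\lambda_t,\mu_t)=\min_{u\in H}J(u,x^t,\lambda_t,\mu_t)$, the sequence $(j_t)_{t\ge 0}$ is monotonically decreasing and therefore convergent.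
   Context: $H$ carries its standard scalar product $\langle\cdot,\cdot\rangle$ (linear in the first argument) and norm $\|\cdot\|$. ''Monotonically decreasing'' is meant in the non-strict sense $j_{t+1}\le j_t$ for all $t$. The relation $x^{t+1}=\operatorname{argmin}_u J(u,x^t,\lambda_t,\mu_t)$ means that $x^{t+1}$ is a minimizer of $u\mapsto J(u,x^t,\lambda_t,\mu_t)$ over $H$. *)

(* Defs.v *)
From HB Require Import structures.
From mathcomp Require Import all_boot all_order all_algebra.
From mathcomp Require Import complex.
From mathcomp Require Import boolp classical_sets reals topology normedtype sequences.
Set Implicit Arguments.
Unset Strict Implicit.
Unset Printing Implicit Defensive.
Import Order.TTheory GRing.Theory Num.Theory.
Import numFieldNormedType.Exports.
Local Open Scope ring_scope.

(* The field over which H is taken, so that one statement covers both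
   H = R^n and H = C^n. *)
Variant scalar_kind := RealScalars | ComplexScalars.

Definition scalar_field (R : realType) (k : scalar_kind) : numFieldType :=
  match k with
  | RealScalars => R
  | ComplexScalars => R[i]
  end.

Section Scalars.
Variables (R : realType) (k : scalar_kind).

Definition of_real : R -> scalar_field R k :=
  match k return R -> scalar_field R k with
  | RealScalars => fun x => x
  | ComplexScalars => fun x => (x%:C)%C
  end.

Definition conj_scalar : scalar_field R k -> scalar_field R k :=
  match k return scalar_field R k -> scalar_field R k with
  | RealScalars => fun z => z
  | ComplexScalars => fun z => conjc z
  end.

(* The library norm of R[i] takes its values in R[i]; normc is its R-valued
   version. *)
Definition modulus : scalar_field R k -> R :=
  match k return scalar_field R k -> R with
  | RealScalars => fun x => `|x|
  | ComplexScalars => fun z => ComplexField.Normc.normc z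
  end.

Variable n : nat.

Definition inner (u v : 'rV[scalar_field R k]_n) : scalar_field R k :=
  \sum_(i < n) u 0 i * conj_scalar (v 0 i).

(* Not the library norm on 'rV, which is the sup norm. *)
Definition hnorm (u : 'rV[scalar_field R k]_n) : R :=
  Num.sqrt (\sum_(i < n) modulus (u 0 i) ^+ 2).

Definition J (m : nat) (f : 'I_m -> 'rV[scalar_field R k]_n) (y : 'I_m -> R)
    (u v : 'rV[scalar_field R k]_n) (lambda mu : R) : R :=
  \sum_(i < m) modulus (of_real (y i) - inner u (f i) * inner (f i) v) ^+ 2
  + lambda * hnorm u ^+ 2 + mu * hnorm (u - v) ^+ 2 + lambda * hnorm v ^+ 2.

End Scalars.

Definition is_argmin (T : Type) (R : realType) (F : T -> R) (x : T) : Prop :=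
  forall u : T, F x <= F u.

(* Main.v *)
(* J is symmetric in (u, v) and nondecreasing in (lambda, mu), so testing the
   minimality of x^(t+2) against x^t gives
   j_(t+1) <= J(x^t, x^(t+1), lambda_(t+1), mu_(t+1))
           <= J(x^t, x^(t+1), lambda_t, mu_t) = j_t,
   and j_t >= 0. *)
Require Import Defs.
From HB Require Import structures.
From mathcomp Require Import all_boot all_order all_algebra.
From mathcomp Require Import complex.
From mathcomp Require Import boolp classical_sets reals topology normedtype sequences.
Import Order.TTheory GRing.Theory Num.Theory.
Import numFieldNormedType.Exports.
Local Open Scope ring_scope.

Section Scalars.
Variables (R : realType) (k : scalar_kind).
Implicit Types a b z : scalar_field R k.

(** Since [conj_scalar] is a match on [k], its laws go by cases: trivial over the reals, those of
    [conjc] over the complex numbers. *)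
Lemma conj_scalarD : {morph @conj_scalar R k : a b / a + b}.
Proof. by case: k => // a b; exact: (rmorphD conjc). Qed.

Lemma conj_scalarB : {morph @conj_scalar R k : a b / a - b}.
Proof. by case: k => // a b; exact: (rmorphB conjc). Qed.

Lemma conj_scalarM : {morph @conj_scalar R k : a b / a * b}.
Proof. by case: k => // a b; exact: (rmorphM conjc). Qed.

Lemma conj_scalar0 : conj_scalar (0 : scalar_field R k) = 0.
Proof. by case: k => //; exact: (rmorph0 conjc). Qed.

Lemma conj_scalarK : involutive (@conj_scalar R k).
Proof. by case: k => // z; exact: conjcK. Qed.

Lemma conj_of_real (r : R) : conj_scalar (of_real k r) = of_real k r.
Proof. by case: k => //; exact: conjc_real. Qed.

Lemma modulus_conj z : modulus (conj_scalar z) = modulus z.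
Proof. by move: z; case: k => // -[a b] /=; rewrite sqrrN. Qed.

Lemma modulusN z : modulus (- z) = modulus z.
Proof. by move: z; case: k => [a|[a b]] /=; rewrite ?normrN ?sqrrN. Qed.

Section Space.
Variable n : nat.
Implicit Types u v : 'rV[scalar_field R k]_n.

(** Hermitian symmetry: conjugation passes through sums and products, and being an involution it
    frees the second factor. *)
Lemma conj_inner u v : conj_scalar (inner u v) = inner v u.
Proof.
rewrite /inner (big_morph _ conj_scalarD conj_scalar0).
by apply: eq_bigr => i _; rewrite conj_scalarM conj_scalarK mulrC.
Qed.

Lemma hnorm_distC u v : hnorm (u - v) = hnorm (v - u).
Proof.
rewrite /hnorm; congr Num.sqrt; apply: eq_bigr => i _.
by rewrite -opprB mxE modulusN.
Qed.

Variables (m : nat) (f : 'I_m -> 'rV[scalar_field R k]_n) (y : 'I_m -> R).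

(* As y is real, swapping u and v conjugates every residual. *)
Lemma J_sym u v (lambda mu : R) : J f y u v lambda mu = J f y v u lambda mu.
Proof.
(* With the [mu] term moved last it cancels; exchanging the two [lambda] terms then leaves only the
   residual sums. *)
rewrite /J hnorm_distC addrAC [RHS]addrAC; congr (_ + _).
rewrite addrAC; congr (_ + _ + _); apply: eq_bigr => i _.
rewrite -modulus_conj conj_scalarB conj_of_real conj_scalarM !conj_inner.
by rewrite mulrC.
Qed.

Lemma J_ge0 u v (lambda mu : R) :
  0 <= lambda -> 0 <= mu -> 0 <= J f y u v lambda mu.
Proof.
move=> l0 m0; rewrite /J; do 3?apply: addr_ge0; last 3 first.
- by rewrite mulr_ge0 ?sqr_ge0.
- by rewrite mulr_ge0 ?sqr_ge0.
- by rewrite mulr_ge0 ?sqr_ge0.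
by apply: sumr_ge0 => i _; exact: sqr_ge0.
Qed.

(** Both parameters only multiply squared norms, and the residual sum does not involve them. *)
Lemma le_J u v (lambda lambda' mu mu' : R) :
  lambda <= lambda' -> mu <= mu' -> J f y u v lambda mu <= J f y u v lambda' mu'.
Proof. by move=> ll mm; rewrite /J !lerD ?ler_wpM2r ?sqr_ge0. Qed.

End Space.
End Scalars.

Theorem theorem3p1 (R : realType) (k : scalar_kind) (n m : nat)
    (f : 'I_m -> 'rV[scalar_field R k]_n)
    (f_span : <<codom f>>%VS = fullv)
    (y : 'I_m -> R)
    (lambda mu : nat -> R)
    (lambda_ge0 : forall t, 0 <= lambda t)
    (mu_ge0 : forall t, 0 <= mu t)
    (lambda_decr : forall t, lambda t.+1 <= lambda t)
    (mu_decr : forall t, mu t.+1 <= mu t)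
    (x0 : 'rV[scalar_field R k]_n)
    (x : nat -> 'rV[scalar_field R k]_n)
    (x_init : x 0%N = x0)
    (x_step : forall t,
       is_argmin (fun u => J f y u (x t) (lambda t) (mu t)) (x t.+1))
    (j : nat -> R)
    (j_def : forall t, j t = J f y (x t.+1) (x t) (lambda t) (mu t)) :
  (forall t, j t.+1 <= j t) /\ cvgn j.
Proof.
have j_decr t : j t.+1 <= j t.
  rewrite !j_def; apply: le_trans (x_step t.+1 (x t)) _.
  (* Swapping the right side alone gives both sides the vectors [x t], [x t.+1] in this order, so
     only the parameters differ. *)
  by rewrite [leRHS]J_sym; exact: le_J.
(* Monotone convergence: the one-step inequality gives monotonicity, and 0 is a lower bound of the
   range. *)
split=> //; apply: nonincreasing_is_cvgn.
  by apply/nonincreasing_seqP.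
by exists 0 => _ [t _ <-]; rewrite j_def; exact: J_ge0.
Qed.
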